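(* Let $\tilde n\ge 1$ and let $(\tilde{\mathbf{x}},\tilde{\mathbf{z}})\in\mathcal{S}_{\tilde n}$. Write $\tilde{\mathbf{P}}(t)=\bigl[P_x(t;\tilde n,\tilde{\mathbf{x}}),\,P_z(t;\tilde n,\tilde{\mathbf{z}})\bigr]^\top$ for $t\in[0,1]$ (a Bézier cdf of degree $\tilde n$), and let $$\kappa=\max\bigl(\|P_x''(\cdot;\tilde n,\tilde{\mathbf{x}})\|_\infty,\ \|P_z''(\cdot;\tilde n,\tilde{\mathbf{z}})\|_\infty\bigr).$$ For any integer $n\ge 1$, let $(\mathbf{x},\mathbf{z})\in\mathbb{R}^{n+1}\times\mathbb{R}^{n+1}$ be given by $$x_i=P_x\bigl(\tfrac{i}{n};\tilde n,\tilde{\mathbf{x}}\bigr),\qquad z_i=P_z\bigl(\tfrac{i}{n};\tilde n,\tilde{\mathbf{z}}\bigr),\qquad i=0,1,\dots,n,$$ and let $\mathbf{P}(t)=\bigl[P_x(t;n,\mathbf{x}),\,P_z(t;n,\mathbf{z})\bigr]^\top$ be the degree-$n$ Bézier curve they generate. Then $(\mathbf{x},\mathbf{z})\in\mathcal{C}_n$ and $$\sup_{t\in[0,1]}\bigl\|\mathbf{P}(t)-\tilde{\mathbf{P}}(t)\bigr\|_\infty\le\frac{\kappa}{8n}.$$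
   Context: Let $X_{(1)}\le\dots\le X_{(m)}$ be a sorted real sample containing at least two distinct values, so $X_{(1)}<X_{(m)}$ (only these two endpoints matter here). For an integer $n\ge 1$ and $0\le i\le n$, $B_{n,i}(t)=\binom{n}{i}t^i(1-t)^{n-i}$ for $t\in[0,1]$ (with $0^0=1$). For $\mathbf{x}=(x_0,\dots,x_n)$ and $\mathbf{z}=(z_0,\dots,z_n)$ in $\mathbb{R}^{n+1}$, set $P_x(t;n,\mathbf{x})=\sum_{i=0}^n B_{n,i}(t)x_i$ and $P_z(t;n,\mathbf{z})=\sum_{i=0}^n B_{n,i}(t)z_i$ for $t\in[0,1]$; primes denote derivatives in $t$. For functions on $[0,1]$, $\|\cdot\|_\infty$ is the sup norm on $[0,1]$; for vectors in $\mathbb{R}^2$ it is the max norm. $\mathcal{S}_n$ is the set of $(\mathbf{x},\mathbf{z})\in\mathbb{R}^{n+1}\times\mathbb{R}^{n+1}$ with $x_0=X_{(1)}$, $x_n=X_{(m)}$, $z_0=0$, $z_n=1$, $P_x'(t;n,\mathbf{x})>0$ for all $t\in(0,1)$, and $P_z'(t;n,\mathbf{z})\ge 0$ for all $t\in[0,1]$. $\mathcal{C}_n$ is the set of $(\mathbf{x},\mathbf{z})\in\mathbb{R}^{n+1}\times\mathbb{R}^{n+1}$ with $x_0=X_{(1)}$, $x_n=X_{(m)}$, $z_0=0$, $z_n=1$, and $x_i\le x_{i+1}$, $z_i\le z_{i+1}$ for $i=0,\dots,n-1$. *)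

(* Defs.v *)
From HB Require Import structures.
From mathcomp Require Import all_boot all_order all_algebra.
From mathcomp Require Import all_classical all_reals all_analysis.

Set Implicit Arguments.
Unset Strict Implicit.
Unset Printing Implicit Defensive.

Import Order.TTheory GRing.Theory Num.Theory.
Import numFieldNormedType.Exports.

Local Open Scope classical_set_scope.
Local Open Scope ring_scope.

Section BezierDefs.
Variable R : realType.

Definition bernstein_basis (n i : nat) (t : R) : R :=
  'C(n, i)%:R * t ^+ i * (1 - t) ^+ (n - i).

(* The polynomial is taken on the whole line; its two-sided derivatives at 0
   and 1 are the one-sided derivatives of its restriction to [0, 1]. *)
Definition bezier (n : nat) (c : 'rV[R]_n.+1) (t : R) : R :=
  \sum_(i < n.+1) bernstein_basis n i t * c ord0 i.

(* The norm of the product R * R is the max norm. *)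
Definition bezier_curve (n : nat) (x z : 'rV[R]_n.+1) (t : R) : R * R :=
  (bezier x t, bezier z t).

(* Extended-real-valued, so that an unbounded function has norm +oo. *)
Definition sup_norm01 (V : normedModType R) (f : R -> V) : \bar R :=
  ereal_sup [set `|f t|%:E | t in `[0, 1]].

Definition sorted_sample (m : nat) (X : 'I_m.+1 -> R) : Prop :=
  forall i j : 'I_m.+1, (i <= j)%N -> X i <= X j.

Definition endpoint_constraints (m : nat) (X : 'I_m.+1 -> R) (n : nat)
    (x z : 'rV[R]_n.+1) : Prop :=
  [/\ x ord0 ord0 = X ord0, x ord0 ord_max = X ord_max,
      z ord0 ord0 = 0 & z ord0 ord_max = 1].

Definition bezier_S (m : nat) (X : 'I_m.+1 -> R) (n : nat) :
    set ('rV[R]_n.+1 * 'rV[R]_n.+1) :=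
  [set c : 'rV[R]_n.+1 * 'rV[R]_n.+1 |
    [/\ endpoint_constraints X c.1 c.2,
        forall t : R, 0 < t < 1 -> 0 < derive1 (bezier c.1) t
      & forall t : R, 0 <= t <= 1 -> 0 <= derive1 (bezier c.2) t]].

Definition nondecreasing_coords (n : nat) (c : 'rV[R]_n.+1) : Prop :=
  forall i : 'I_n, c ord0 (widen_ord (leqnSn n) i) <= c ord0 (lift ord0 i).

Definition bezier_C (m : nat) (X : 'I_m.+1 -> R) (n : nat) :
    set ('rV[R]_n.+1 * 'rV[R]_n.+1) :=
  [set c : 'rV[R]_n.+1 * 'rV[R]_n.+1 |
    [/\ endpoint_constraints X c.1 c.2,
        nondecreasing_coords c.1 & nondecreasing_coords c.2]].

End BezierDefs.

Arguments bezier_S {R m} X n.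
Arguments bezier_C {R m} X n.

(* Main.v *)
(* The curve P is the Bernstein approximation of P~.  Bernstein averages have
   mean t and variance t(1-t)/n, so by the tangent-line form of Jensen's
   inequality the approximation of a convex function lies above it.  Applying
   this to the convex polynomials (k/2) t^2 + p and (k/2) t^2 - p, where
   |p''| <= k, bounds the error by (k/2) t(1-t)/n <= k/(8n). *)

Require Import Defs.
From HB Require Import structures.
From mathcomp Require Import all_boot all_order all_algebra.
From mathcomp Require Import all_classical all_reals all_analysis.
From mathcomp Require Import ring lra.
From mathcomp Require polyrcf.

Import Order.TTheory GRing.Theory Num.Theory.
Import numFieldNormedType.Exports.

Local Open Scope classical_set_scope.
Local Open Scope ring_scope.

(** * Bernstein averages of polynomials and their approximation error *)

Section Bernstein.
Variable R : realType.
Implicit Types (n : nat) (t a b : R) (p : {poly R}).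

Lemma bernstein_basis_ge0 n i t : 0 <= t <= 1 -> 0 <= bernstein_basis n i t.
Proof.
move=> /andP[t0 t1].
by rewrite /bernstein_basis !mulr_ge0 ?exprn_ge0 ?subr_ge0 ?ler0n.
Qed.

Lemma bernstein_basis_small n i t : (n < i)%N -> bernstein_basis n i t = 0.
Proof. by move=> lt_ni; rewrite /bernstein_basis bin_small// !mul0r. Qed.

Lemma bernstein_basisS0 n t :
  bernstein_basis n.+1 0 t = (1 - t) * bernstein_basis n 0 t.
Proof. by rewrite /bernstein_basis !bin0 !subn0 exprS; ring. Qed.

Lemma bernstein_basisSS n i t : (i <= n)%N ->
  bernstein_basis n.+1 i.+1 t =
  (1 - t) * bernstein_basis n i.+1 t + t * bernstein_basis n i t.
Proof.
move=> le_in; rewrite /bernstein_basis binS natrD subSS exprS.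
(* The case [i = n] is separate: there [n - i.+1] truncates to 0, but the binomial coefficient in
   front vanishes. *)
move: le_in; rewrite leq_eqVlt => /orP[/eqP ->|lt_in].
  by rewrite bin_small// subnn expr0; ring.
by rewrite -(subnSK lt_in) exprS; ring.
Qed.

(** Pascal's rule, read as conditioning a binomial variable on one Bernoulli trial: failure keeps
    [g], success shifts its argument. Taking [g] on [nat] makes the shift meaningful. *)
Lemma bernstein_sumS n t (g : nat -> R) :
  \sum_(i < n.+2) bernstein_basis n.+1 i t * g i =
  (1 - t) * (\sum_(i < n.+1) bernstein_basis n i t * g i) +
  t * (\sum_(i < n.+1) bernstein_basis n i t * g i.+1).
Proof.
rewrite big_ord_recl bernstein_basisS0.
under eq_bigr => i _ do
  rewrite lift0 (bernstein_basisSS n i _ (ltn_ord i)) mulrDl -(mulrA (1 - t)) -(mulrA t).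
rewrite big_split /= -!mulr_sumr addrA; congr (_ + _).
(* The last term carries the weight of index [n.+1] in degree [n], which is 0; the others, joined to
   the index-0 term, rebuild the unshifted sum. *)
rewrite big_ord_recr /= (bernstein_basis_small n n.+1)// mul0r addr0.
by rewrite [in RHS]big_ord_recl [in RHS]mulrDr [in RHS]mulrA.
Qed.

(** The first two moments of the binomial law. All three coefficients are general because the shift
    of a quadratic is again a quadratic, so the induction closes. *)
Lemma bernstein_sum_quadratic n t a b c :
  \sum_(i < n.+1) bernstein_basis n i t * (a + b * i%:R + c * i%:R ^+ 2) =
  a + b * (n%:R * t) + c * (n%:R * t * (1 - t) + (n%:R * t) ^+ 2).
Proof.
elim: n a b c => [|n IHn] a b c.
  by rewrite big_ord1 /bernstein_basis bin0 /= !expr0; ring.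
rewrite (bernstein_sumS n t (fun i => a + b * i%:R + c * i%:R ^+ 2)) IHn.
have shift (i : nat) : a + b * i.+1%:R + c * i.+1%:R ^+ 2 =
    (a + b + c) + (b + 2 * c) * i%:R + c * i%:R ^+ 2 by rewrite -natr1; ring.
under eq_bigr => i _ do rewrite shift.
by rewrite IHn -natr1; ring.
Qed.

Lemma poly_nondecreasing p a b : a <= b ->
  (forall t, a < t < b -> 0 <= p^`().[t]) -> p.[a] <= p.[b].
Proof.
rewrite le_eqVlt => /orP[/eqP -> //|lt_ab] dp_ge0.
have [c cab e] := polyrcf.poly_mvt p lt_ab.
rewrite -subr_ge0 e mulr_ge0 ?subr_ge0 ?(ltW lt_ab)//.
by apply: dp_ge0; rewrite in_itv in cab.
Qed.

Lemma poly_tangent_le p a b : 0 <= a <= 1 -> 0 <= b <= 1 ->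
  (forall t, 0 <= t <= 1 -> 0 <= p^`()^`().[t]) ->
  p.[a] + p^`().[a] * (b - a) <= p.[b].
Proof.
move=> a01 b01 d2p_ge0.
have dp_mono u v : 0 <= u -> u <= v -> v <= 1 -> p^`().[u] <= p^`().[v].
  by move=> *; apply: poly_nondecreasing => // t ?; apply: d2p_ge0; lra.
have [lt_ab|lt_ba|->] := ltgtP a b; last by rewrite subrr mulr0 addr0.
- have [c cab /eqP] := polyrcf.poly_mvt p lt_ab.
  rewrite subr_eq => /eqP ->; rewrite in_itv/= in cab.
  have dp_ac : p^`().[a] <= p^`().[c] by apply: dp_mono; lra.
  by rewrite addrC lerD2r ler_wpM2r// subr_ge0 ltW.
- have [c cba e] := polyrcf.poly_mvt p lt_ba; rewrite in_itv/= in cba.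
  have dp_ca : p^`().[c] <= p^`().[a] by apply: dp_mono; lra.
  have : p^`().[c] * (a - b) <= p^`().[a] * (a - b).
    by rewrite ler_wpM2r// subr_ge0 ltW.
  by rewrite -e; lra.
Qed.

Lemma node01 n i : (i <= n)%N -> 0 <= (i%:R / n%:R : R) <= 1.
Proof.
(* For [n = 0] the quotient is 0, since the inverse of 0 is 0. *)
case: n => [|n]; first by rewrite invr0 mulr0 lexx ler01.
by move=> le_in; rewrite divr_ge0//= ler_pdivrMr ?ltr0Sn// mul1r ler_nat.
Qed.

Lemma bernstein_convex_ge n p t : (0 < n)%N -> 0 <= t <= 1 ->
  (forall s, 0 <= s <= 1 -> 0 <= p^`()^`().[s]) ->
  p.[t] <= \sum_(i < n.+1) bernstein_basis n i t * p.[i%:R / n%:R].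
Proof.
move=> n_gt0 t01 d2p_ge0; have n0 : n%:R != 0 :> R by rewrite pnatr_eq0 -lt0n.
have tangentE (i : nat) : p.[t] + p^`().[t] * (i%:R / n%:R - t) =
    (p.[t] - p^`().[t] * t) + p^`().[t] / n%:R * i%:R + 0 * i%:R ^+ 2.
  by ring.
(* The nodes have mean [t], so the tangent line at [t] averages to its value there; it then remains
   to compare term by term. *)
have -> : p.[t] = \sum_(i < n.+1) bernstein_basis n i t *
    (p.[t] + p^`().[t] * (i%:R / n%:R - t)).
  under eq_bigr => i _ do rewrite tangentE.
  by rewrite bernstein_sum_quadratic; field.
apply: ler_sum => i _; apply: ler_wpM2l; first exact: bernstein_basis_ge0.
by apply: poly_tangent_le => //; apply: node01; rewrite -ltnS.
Qed.

Lemma bernstein_approx_ge n p k t : (0 < n)%N -> 0 <= t <= 1 ->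
  (forall s, 0 <= s <= 1 -> `|p^`()^`().[s]| <= k) ->
  p.[t] - \sum_(i < n.+1) bernstein_basis n i t * p.[i%:R / n%:R]
    <= k / (8 * n%:R).
Proof.
move=> n_gt0 t01 d2p_le; have n_pos : 0 < n%:R :> R by rewrite ltr0n.
have n0 : n%:R != 0 :> R by rewrite gt_eqF.
have k_ge0 : 0 <= k by rewrite (le_trans (normr_ge0 _) (d2p_le t t01)).
(* Chosen so that the second derivative is [k] plus that of [p], hence nonnegative on [0, 1]. *)
pose q := (k / 2) *: 'X^2 + p.
have qE s : q.[s] = k / 2 * s ^+ 2 + p.[s] by rewrite !hornerE.
have d2q_ge0 s : 0 <= s <= 1 -> 0 <= q^`()^`().[s].
  move=> s01; have := d2p_le s s01; rewrite ler_norml => /andP[+ _].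
  rewrite /q !poly.derivE !hornerE /=.
  lra.
have := bernstein_convex_ge _ _ _ n_gt0 t01 d2q_ge0.
under eq_bigr => i _ do rewrite qE mulrDr.
rewrite big_split /= qE.
(* Puts the square in the shape required by [bernstein_sum_quadratic]. *)
have sqE (i : nat) : k / 2 * (i%:R / n%:R) ^+ 2 =
    0 + 0 * i%:R + k / 2 / n%:R ^+ 2 * i%:R ^+ 2 :> R by field.
under eq_bigr => i _ do rewrite sqE.
rewrite bernstein_sum_quadratic.
set S := \sum_(_ < _) _.
(* The constant 8 comes from [4 * t * (1 - t) = 1 - (1 - 2 * t) ^+ 2]; the subtracted square is
   discarded next. *)
have -> : 0 + 0 * (n%:R * t) +
    k / 2 / n%:R ^+ 2 * (n%:R * t * (1 - t) + (n%:R * t) ^+ 2) =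
    k / 2 * t ^+ 2 + k / (8 * n%:R) - k / (8 * n%:R) * (1 - 2 * t) ^+ 2.
  by field.
have : 0 <= k / (8 * n%:R) * (1 - 2 * t) ^+ 2.
  by rewrite mulr_ge0 ?sqr_ge0// divr_ge0// mulr_ge0// ltW.
lra.
Qed.

Lemma bernstein_approx n p k t : (0 < n)%N -> 0 <= t <= 1 ->
  (forall s, 0 <= s <= 1 -> `|p^`()^`().[s]| <= k) ->
  `|\sum_(i < n.+1) bernstein_basis n i t * p.[i%:R / n%:R] - p.[t]|
    <= k / (8 * n%:R).
Proof.
move=> n_gt0 t01 d2p_le.
have upper := bernstein_approx_ge _ _ _ _ n_gt0 t01 d2p_le.
have d2Np_le s : 0 <= s <= 1 -> `|(- p)^`()^`().[s]| <= k.
  by move=> s01; rewrite !derivN hornerN normrN d2p_le.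
have := bernstein_approx_ge _ _ _ _ n_gt0 t01 d2Np_le.
under eq_bigr => i _ do rewrite hornerN mulrN.
rewrite sumrN hornerN opprK ler_norml => lower; lra.
Qed.

End Bernstein.

(** * Bézier functions as polynomials, and sampling them at the nodes *)

Section Bezier.
Variable R : realType.
Implicit Types (n : nat).

(** A formal polynomial, so that analytic derivatives of [bezier] become formal ones and the
    polynomial lemmas above apply. *)
Definition bezier_poly n (c : 'rV[R]_n.+1) : {poly R} :=
  \sum_(i < n.+1) (c ord0 i * 'C(n, i)%:R) *: ('X^i * (1 - 'X) ^+ (n - i)).

Lemma bezier_polyE n (c : 'rV[R]_n.+1) : bezier c = horner (bezier_poly n c).
Proof.
apply/funext => t; rewrite /bezier /bezier_poly horner_sum.
apply: eq_bigr => i _; rewrite /bernstein_basis.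
by rewrite hornerZ hornerM hornerXn horner_exp !hornerE /=; ring.
Qed.

Lemma derive1_bezier n (c : 'rV[R]_n.+1) :
  derive1 (bezier c) = horner (bezier_poly n c)^`().
Proof. by rewrite bezier_polyE derive.derivE. Qed.

Lemma derive2_bezier n (c : 'rV[R]_n.+1) :
  derive1n 2 (bezier c) = horner (bezier_poly n c)^`()^`().
Proof. by rewrite derive1nS derive1n1 derive1_bezier -derive.derivE. Qed.

Lemma bezier0 n (c : 'rV[R]_n.+1) : bezier c 0 = c ord0 ord0.
Proof.
rewrite /bezier big_ord_recl /bernstein_basis /= bin0 subr0 expr1n expr0.
by rewrite !mul1r big1 ?addr0// => i _; rewrite expr0n /= mulr0 !mul0r.
Qed.

Lemma bezier1 n (c : 'rV[R]_n.+1) : bezier c 1 = c ord0 ord_max.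
Proof.
rewrite /bezier big_ord_recr /bernstein_basis /= binn subnn expr1n expr0.
rewrite !mul1r big1 ?add0r// => i _.
by rewrite subrr expr0n subn_eq0 leqNgt ltn_ord mulr0 mul0r.
Qed.

Lemma sup_norm01_ge (V : normedModType R) (f : R -> V) t :
  0 <= t <= 1 -> (`|f t|%:E <= sup_norm01 f)%E.
Proof.
by move=> t01; apply: ereal_sup_ubound; exists t => //=; rewrite in_itv.
Qed.

(** The open interval between consecutive nodes lies in (0, 1), so the sign of the derivative there
    is enough. This serves both coordinates of [bezier_S]. *)
Lemma bezier_sample_nondecreasing n' n (c' : 'rV[R]_n'.+1) (c : 'rV[R]_n.+1) :
  (forall t, 0 < t < 1 -> 0 <= derive1 (bezier c') t) ->
  (forall i, c ord0 i = bezier c' (i%:R / n%:R)) -> nondecreasing_coords c.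
Proof.
move=> dc'_ge0 cE i; rewrite !cE lift0 bezier_polyE /=.
apply: poly_nondecreasing.
  by rewrite ler_wpM2r ?invr_ge0// ler_nat.
move=> t /andP[it ti]; rewrite -derive1_bezier; apply: dc'_ge0.
have /andP[i0 _] := node01 R n i (ltnW (ltn_ord i)).
have /andP[_ i1] := node01 R n i.+1 (ltn_ord i).
by rewrite (le_lt_trans i0 it) (lt_le_trans ti i1).
Qed.

(** With sampled coefficients, [bezier c] is exactly the degree-[n] Bernstein average of
    [bezier_poly n' c']. *)
Lemma bezier_sample_error n' n (c' : 'rV[R]_n'.+1) (c : 'rV[R]_n.+1) k t :
  (0 < n)%N -> 0 <= t <= 1 ->
  (sup_norm01 (derive1n 2 (bezier c')) <= k%:E)%E ->
  (forall i, c ord0 i = bezier c' (i%:R / n%:R)) ->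
  `|bezier c t - bezier c' t| <= k / (8 * n%:R).
Proof.
move=> n_gt0 t01 norm_le cE.
have -> : bezier c t = \sum_(i < n.+1) bernstein_basis n i t *
    (bezier_poly n' c').[i%:R / n%:R].
  by apply: eq_bigr => i _; rewrite cE bezier_polyE.
rewrite bezier_polyE; apply: bernstein_approx => // s s01.
rewrite -lee_fin; apply: le_trans norm_le.
by rewrite derive2_bezier; apply: (sup_norm01_ge _ _ _ s01).
Qed.

End Bezier.

Theorem theorem1 (R : realType)
    (m : nat) (X : 'I_m.+1 -> R)
    (X_sorted : sorted_sample X) (X_distinct : exists i j, X i != X j)
    (n' : nat) (n'_ge1 : (1 <= n')%N) (x' z' : 'rV[R]_n'.+1)
    (xz'_S : bezier_S X n' (x', z'))
    (n : nat) (n_ge1 : (1 <= n)%N) (x z : 'rV[R]_n.+1)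
    (xE : forall i : 'I_n.+1, x ord0 i = bezier x' (i%:R / n%:R))
    (zE : forall i : 'I_n.+1, z ord0 i = bezier z' (i%:R / n%:R)) :
  let kappa : \bar R :=
    maxe (sup_norm01 (derive1n 2 (bezier x')))
         (sup_norm01 (derive1n 2 (bezier z'))) in
  bezier_C X n (x, z) /\
  (sup_norm01 (fun t => (bezier_curve x z t - bezier_curve x' z' t)%R)
     <= kappa * ((8 * n%:R)^-1)%:E)%E.
Proof.
move=> kappa; case: xz'_S => /= -[x'0 x'1 z'0 z'1] dx' dz'.
have n0 : n%:R != 0 :> R by rewrite pnatr_eq0 -lt0n.
have n8 : 0 < (8 * n%:R)^-1 :> R by rewrite invr_gt0 mulr_gt0// ltr0n.
split.
  split => /=.
  - split; rewrite ?xE ?zE /=.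
    + by rewrite mul0r bezier0.
    + by rewrite divff// bezier1.
    + by rewrite mul0r bezier0.
    + by rewrite divff// bezier1.
  - apply: bezier_sample_nondecreasing xE => t t01; exact/ltW/dx'.
  - apply: bezier_sample_nondecreasing zE => t /andP[t0 t1].
    by apply: dz'; rewrite !ltW.
apply: ge_ereal_sup => _ [t /= t01 <-]; rewrite in_itv/= in t01.
have le_maxe (a b : \bar R) : (a <= maxe a b)%E /\ (b <= maxe a b)%E.
  by rewrite !le_max !lexx orbT.
have [kx kz] := le_maxe (sup_norm01 (derive1n 2 (bezier x')))
  (sup_norm01 (derive1n 2 (bezier z'))).
rewrite -/kappa in kx kz.
have kappa_ge0 : (0 <= kappa)%E.
  apply: le_trans kx; apply: le_trans (sup_norm01_ge _ _ _ _ t01).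
  by rewrite lee_fin.
(* Nonnegativity excludes [-oo]. At [+oo] the right-hand side is [+oo] because the factor is
   positive, so only a real [k] remains. *)
case: kappa kx kz kappa_ge0 => [k||] kx kz k0 //; last first.
  by rewrite gt0_mulye ?lte_fin// leey.
(* The max norm on [R * R] reduces the bound to one inequality per coordinate. *)
rewrite -EFinM lee_fin prod_normE ge_max /=; apply/andP; split.
- exact: (bezier_sample_error _ _ _ _ _ _ _ n_ge1 t01 kx xE).
- exact: (bezier_sample_error _ _ _ _ _ _ _ n_ge1 t01 kz zE).
Qed.
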